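(* Let $k\ge1$, and let $\mathbf X=(X_n)_{n\in\mathbb N}$ and $\widetilde{\mathbf X}=(\widetilde X_n)_{n\in\mathbb N}$ be two Markov chains on $E_k=\{0,\dots,k\}$, both having initial measure concentrated at $0$, with transition matrices $P$ and $\widetilde P$ respectively. Let $k$ be an absorbing state for both matrices. Assume that there exist two coprime positive integers $n_1,n_2$ such that $\widetilde P^{\,n_1}\unlhd P^{\,n_1}$ and $\widetilde P^{\,n_2}\unlhd P^{\,n_2}$. Then a. $T_k\preceq_{a.st.}\widetilde T_k$. If, moreover, $\widetilde p^{(n)}_{0,k}\le p^{(n)}_{0,k}$ for $n=1,\dots,\hat n(n_1,n_2)-1$, then b. $T_k\preceq_{st}\widetilde T_k$.
   Context: For probability distributions $\mu,\nu$ on $\{0,\dots,k\}$, $\mu\preceq_{st}\nu$ means $\sum_{l=j}^k\mu_l\le\sum_{l=j}^k\nu_l$ for every $j=0,\dots,k$. For stochastic matrices $A=(a_{i,j})_{i,j=0,\dots,k}$ and $A'=(a'_{i,j})_{i,j=0,\dots,k}$, write $A'\unlhd A$ if and only if $a'_{i,\cdot}\preceq_{st}a_{j,\cdot}$ for all $0\le i\le j\le k$, where $a_{j,\cdot}$ is the $j$-th row of $A$ and $a'_{i,\cdot}$ the $i$-th row of $A'$. $p^{(n)}_{i,j}$ and $\widetilde p^{(n)}_{i,j}$ are the $(i,j)$ entries of $P^n$ and $\widetilde P^n$. $\mathbb N=\{0,1,2,\dots\}$, and $$\hat n(n_1,n_2)=\inf\{r\in\mathbb N:\ \text{every integer } r'\ge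 r \text{ can be written as } r'=an_1+bn_2 \text{ with } a,b\in\mathbb N\}.$$ $T_k=\inf\{n\in\mathbb N:X_n\ge k\}$ and $\widetilde T_k=\inf\{n\in\mathbb N:\widetilde X_n\ge k\}$, with $\inf\emptyset=+\infty$. For (possibly $+\infty$-valued) random variables $X,Y$: $X\preceq_{st}Y$ means $\mathbb P(X>t)\le\mathbb P(Y>t)$ for every $t\in\mathbb R$; $X\preceq_{a.st.}Y$ means that there exists $t_0\in\mathbb R$ such that $\mathbb P(X>t)\le\mathbb P(Y>t)$ for every $t\ge t_0$. *)

(* Defs.v *)
From mathcomp Require Export all_boot all_order all_algebra.
From mathcomp Require Export all_classical all_reals all_analysis.

Set Implicit Arguments.
Unset Strict Implicit.
Unset Printing Implicit Defensive.

Import Order.TTheory GRing.Theory Num.Theory.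
Local Open Scope classical_set_scope.
Local Open Scope ring_scope.

(* The state space {0, ..., k} is 'I_k.+1, with 0 = ord0 and k = ord_max. *)

Definition stochastic_mx (R : realType) (k : nat) (A : 'M[R]_k.+1) : Prop :=
  (forall i j, 0 <= A i j) /\ (forall i, \sum_j A i j = 1).

Definition absorbing (R : realType) (k : nat) (A : 'M[R]_k.+1) (i : 'I_k.+1) :
  Prop := A i i = 1.

Definition dist_st_le (R : realType) (k : nat) (mu nu : 'I_k.+1 -> R) : Prop :=
  forall j : 'I_k.+1,
    \sum_(l < k.+1 | (j <= l)%N) mu l <= \sum_(l < k.+1 | (j <= l)%N) nu l.

Definition mx_dominated (R : realType) (k : nat) (A' A : 'M[R]_k.+1) : Prop :=
  forall i j : 'I_k.+1, (i <= j)%N -> dist_st_le (A' i) (A j).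

(* Infimum of a set of naturals in the extended reals; it is +oo on set0. *)
Definition nat_einf (R : realType) (S : set nat) : \bar R :=
  ereal_inf [set n%:R%:E | n in S].

Definition hat_n (R : realType) (n1 n2 : nat) : \bar R :=
  nat_einf R [set r | forall r', (r <= r')%N ->
                        exists a b : nat, r' = (a * n1 + b * n2)%N].

(* Only used below when Pr B > 0. *)
Definition cond_prob (R : realType) (d : measure_display)
    (Omega : measurableType d) (Pr : probability Omega R) (A B : set Omega) : R :=
  fine (Pr (A `&` B)) / fine (Pr B).

(* Time-homogeneous Markov chain with transition matrix A and initial law the
   unit mass at 0. The state space carries its discrete sigma-algebra. *)
Record markov_chain_from0 (R : realType) (d : measure_display)
    (Omega : measurableType d) (Pr : probability Omega R) (k : nat)
    (A : 'M[R]_k.+1) (X : nat -> Omega -> 'I_k.+1) : Prop := MarkovChainFrom0 {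
  mc_stochastic : stochastic_mx A ;
  mc_measurable : forall n (B : set 'I_k.+1), measurable (X n @^-1` B) ;
  mc_init : Pr (X 0%N @^-1` [set ord0]) = 1%E ;
  mc_transition : forall (n : nat) (x : nat -> 'I_k.+1) (j : 'I_k.+1),
    let history := [set w | forall m, (m <= n)%N -> X m w = x m] in
    (0 < Pr history)%E ->
    cond_prob Pr (X n.+1 @^-1` [set j]) history = A (x n) j }.

Definition hitting_time (R : realType) (k : nat) (Omega : Type)
    (X : nat -> Omega -> 'I_k.+1) (w : Omega) : \bar R :=
  nat_einf R [set n | (k <= X n w)%N].

(* The variables may live on different probability spaces. *)
Definition st_le (R : realType) (d d' : measure_display)
    (Omega : measurableType d) (Omega' : measurableType d')
    (Pr : probability Omega R) (Pr' : probability Omega' R)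
    (X : Omega -> \bar R) (Y : Omega' -> \bar R) : Prop :=
  forall t : R,
    (Pr [set w | (t%:E < X w)%E] <= Pr' [set w | (t%:E < Y w)%E])%E.

Definition ast_le (R : realType) (d d' : measure_display)
    (Omega : measurableType d) (Omega' : measurableType d')
    (Pr : probability Omega R) (Pr' : probability Omega' R)
    (X : Omega -> \bar R) (Y : Omega' -> \bar R) : Prop :=
  exists t0 : R, forall t : R, t0 <= t ->
    (Pr [set w | (t%:E < X w)%E] <= Pr' [set w | (t%:E < Y w)%E])%E.

(* Main.v *)
(* The relation A' <| A is compatible with products: a test function
   monotone between the tails of the rows of B' and of B, here the running
   maximum of the former, has ordered integrals. Hence P'^n <| P^n for every
   n = a n1 + b n2, that is, for all large n when n1 and n2 are coprime. As k
   is absorbing, T_k <= n and X_n = k differ by a null event, so that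
   Pr (T_k > n) = 1 - P^n(0, k), and the entry (0, k) is what <| compares. *)
Require Import Defs.
Set Implicit Arguments.
Unset Strict Implicit.
Unset Printing Implicit Defensive.
Import Order.TTheory GRing.Theory Num.Theory.
Local Open Scope classical_set_scope.
Local Open Scope ring_scope.

(** * Tails of distributions and monotone test functions *)

(** Summation by parts: each [h l] telescopes, and exchanging the sums gathers the mass beyond each
    increment. The last increment meets an empty tail. *)
Lemma Abel_sum_tails (R : realType) (n : nat) (h : nat -> R) (mu : 'I_n -> R) :
  \sum_l mu l * h l = h 0%N * (\sum_l mu l) +
    \sum_(0 <= j < n) (h j.+1 - h j) * \sum_(l < n | (j.+1 <= l)%N) mu l.
Proof.
have E (l : 'I_n) :
    h l = h 0%N + \sum_(0 <= j < n | (j.+1 <= l)%N) (h j.+1 - h j).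
  have := telescope_sumr h (leq0n l).
  rewrite (big_nat_widen _ _ _ _ _ (ltnW (ltn_ord l))) /= => ->.
  by rewrite addrC subrK.
under eq_bigr => l _ do rewrite E mulrDr mulr_sumr mulrC.
rewrite big_split /= -mulr_sumr; congr (_ + _).
rewrite (exchange_big_dep xpredT) //=; apply: eq_bigr => j _.
by rewrite mulr_sumr; apply: eq_bigr => l _; rewrite mulrC.
Qed.

(** Both masses are 1, so the [h 0] terms of the Abel formula agree, and the nonnegative increments
    weigh ordered tails. *)
Lemma dist_st_le_mono (R : realType) (k : nat) (mu nu : 'I_k.+1 -> R)
    (h : nat -> R) :
  \sum_l mu l = 1 -> \sum_l nu l = 1 -> dist_st_le mu nu ->
  {homo h : m n / (m <= n)%N >-> m <= n} ->
  \sum_l mu l * h l <= \sum_l nu l * h l.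
Proof.
move=> mu1 nu1 munu hmono; rewrite !Abel_sum_tails mu1 nu1 lerD2l.
rewrite !big_mkord; apply: ler_sum => j _.
apply: ler_wpM2l; first by rewrite subr_ge0 hmono.
have [jk|kj] := ltnP j k; first exact: (munu (Ordinal (jk : j.+1 < k.+1)%N)).
by rewrite !big_pred0 // => l; apply/negbTE; rewrite -leqNgt;
  apply: leq_trans kj; rewrite -ltnS.
Qed.

(** * Stochastic matrices and domination under products *)

Lemma stochastic_mxM (R : realType) (k : nat) (A B : 'M[R]_k.+1) :
  stochastic_mx A -> stochastic_mx B -> stochastic_mx (A * B).
Proof.
move=> [A0 A1] [B0 B1]; split=> [i j|i].
  by rewrite mxE; apply: sumr_ge0 => l _; rewrite mulr_ge0.
under eq_bigr => j _ do rewrite mxE.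
rewrite exchange_big /= -[RHS](A1 i); apply: eq_bigr => l _.
by rewrite -mulr_sumr B1 mulr1.
Qed.

Lemma stochastic_mx1 (R : realType) (k : nat) :
  stochastic_mx (1 : 'M[R]_k.+1).
Proof.
split=> [i j|i]; first by rewrite mxE ler0n.
rewrite (bigD1 i) //= mxE eqxx big1 ?addr0 // => j ji.
by rewrite mxE eq_sym (negbTE ji).
Qed.

Lemma stochastic_mxX (R : realType) (k n : nat) (A : 'M[R]_k.+1) :
  stochastic_mx A -> stochastic_mx (A ^+ n).
Proof.
move=> A_st; elim: n => [|n IHn]; first exact: stochastic_mx1.
by rewrite exprS; apply: stochastic_mxM.
Qed.

(** The rows of [1] are point masses, stochastically increasing in their location. *)
Lemma mx_dominated1 (R : realType) (k : nat) :
  mx_dominated (1 : 'M[R]_k.+1) 1.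
Proof.
have tail (i q : 'I_k.+1) :
    \sum_(l < k.+1 | (q <= l)%N) (1 : 'M[R]_k.+1) i l = (q <= i)%N%:R.
  have [qi|iq] := leqP q i.
    rewrite (bigD1 i) //= mxE eqxx big1 ?addr0 // => j /andP[_ ji].
    by rewrite mxE eq_sym (negbTE ji).
  rewrite big1 // => j qj; rewrite mxE; case: eqP => // ij.
  by move: iq; rewrite ij ltnNge qj.
move=> i j ij q; rewrite !tail ler_nat.
by case: (leqP q i) => // qi; rewrite (leq_trans qi ij).
Qed.

Lemma mx_dominatedM (R : realType) (k : nat) (A A' B B' : 'M[R]_k.+1) :
  stochastic_mx A -> stochastic_mx A' ->
  mx_dominated A' A -> mx_dominated B' B -> mx_dominated (A' * B') (A * B).
Proof.
move=> [A0 A1] [A'0 A'1] domA domB i j ij q.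
pose tail (M : 'M[R]_k.+1) l := \sum_(m < k.+1 | (q <= m)%N) M l m.
have tailM (M N : 'M[R]_k.+1) l : tail (M * N) l = \sum_m M l m * tail N m.
  rewrite /tail; under eq_bigr => m _ do rewrite mxE.
  by rewrite exchange_big /=; apply: eq_bigr => m _; rewrite mulr_sumr.
rewrite -/(tail _ i) -/(tail _ j) !tailM.
(* A nondecreasing function squeezed between the two tails. *)
pose h (n : nat) := \big[Order.max/tail B' ord0]_(m < k.+1 | (m <= n)%N) tail B' m.
have hmono : {homo h : m n / (m <= n)%N >-> m <= n}.
  move=> m n mn; apply/bigmax_leP; split=> [|l lm].
    exact: bigmax_ge_id.
  exact/le_bigmax_cond/(leq_trans lm mn).
have lt_h (l : 'I_k.+1) : tail B' l <= h l by apply: le_bigmax_cond.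
(* Every term of the maximum has index [m <= l], so this uses domination between distinct rows, not
   only equal ones. *)
have ht (l : 'I_k.+1) : h l <= tail B l.
  by apply/bigmax_leP; split=> [|m ml]; apply: domB.
apply: (@le_trans _ _ (\sum_m A' i m * h m)).
  by apply: ler_sum => m _; apply: ler_wpM2l.
apply: (@le_trans _ _ (\sum_m A j m * h m)).
  by apply: dist_st_le_mono => //; apply: domA.
by apply: ler_sum => m _; apply: ler_wpM2l.
Qed.

Lemma mx_dominatedX (R : realType) (k n : nat) (A A' : 'M[R]_k.+1) :
  stochastic_mx A -> stochastic_mx A' ->
  mx_dominated A' A -> mx_dominated (A' ^+ n) (A ^+ n).
Proof.
move=> A_st A'_st domA; elim: n => [|n IHn]; first exact: mx_dominated1.
by rewrite !exprS; apply: mx_dominatedM.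
Qed.

Lemma mx_dominated_ord0_max (R : realType) (k : nat) (A A' : 'M[R]_k.+1) :
  mx_dominated A' A -> A' ord0 ord_max <= A ord0 ord_max.
Proof.
have tail (M : 'M[R]_k.+1) :
    \sum_(l < k.+1 | (@ord_max k <= l)%N) M ord0 l = M ord0 ord_max.
  rewrite (big_pred1 ord_max) // => l /=.
  by rewrite -val_eqE /= eqn_leq leq_ord.
by move=> /(_ ord0 ord0 isT ord_max); rewrite !tail.
Qed.

(** * Combinations of two coprime integers *)

Lemma coprime_representable (n1 n2 r : nat) :
  (0 < n1)%N -> (0 < n2)%N -> coprime n1 n2 -> (n1 * n2 <= r)%N ->
  exists a b : nat, r = (a * n1 + b * n2)%N.
Proof.
move=> n1_gt0 n2_gt0 cop le_r.
case: (egcdnP n2 n1_gt0) => u v uv _.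
move: uv; rewrite (eqP cop) => uv.
(* As [u] inverts [n1] modulo [n2], [a * n1] is congruent to [r]; reducing modulo [n2] keeps it at
   most [n1 * n2]. *)
pose a := ((r * u) %% n2)%N.
have ar : (a * n1 = r %[mod n2])%N.
  by rewrite /a modnMml -mulnA uv mulnDr muln1 mulnA modnMDl.
have a_le : (a * n1 <= r)%N.
  by apply: leq_trans le_r; rewrite mulnC leq_mul2l ltnW ?orbT // ltn_mod.
exists a, ((r - a * n1) %/ n2)%N.
rewrite divnK ?subnKC //.
by rewrite -eqn_mod_dvd // ar.
Qed.

(** * Infima of sets of naturals *)

Lemma nat_einf_min (R : realType) (S : set nat) (m : nat) :
  S m -> (forall n, S n -> (m <= n)%N) -> nat_einf R S = m%:R%:E.
Proof.
move=> Sm mmin; apply/eqP; rewrite eq_le; apply/andP; split.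
  by apply: ereal_inf_lbound; exists m.
by apply: le_ereal_inf_tmp => _ [n Sn <-]; rewrite lee_fin ler_nat mmin.
Qed.

Lemma nat_set_min (S : set nat) :
  S !=set0 -> exists2 m, S m & forall n, S n -> (m <= n)%N.
Proof.
case=> n0 Sn0; have ex : exists n, `[< S n >] by exists n0; apply/asboolP.
case: (ex_minnP ex) => m /asboolP Sm mmin.
by exists m => // n Sn; apply/mmin/asboolP.
Qed.

(** The inequality stays strict because a nonempty set of naturals attains its infimum; the empty
    set gives [+oo]. *)
Lemma lt_nat_einf (R : realType) (S : set nat) (t : R) :
  (t%:E < nat_einf R S)%E <-> (forall n, S n -> t < n%:R).
Proof.
split=> [tS n Sn|tS].
  by rewrite -lte_fin (lt_le_trans tS) //; apply: ereal_inf_lbound; exists n.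
have [->|/set0P/nat_set_min[m Sm mmin]] := eqVneq S set0.
  by rewrite /nat_einf image_set0 ereal_inf0 ltry.
by rewrite (nat_einf_min _ Sm mmin) lte_fin tS.
Qed.

(** * Law of the chain and absorption *)

Lemma prob_partition (R : realType) (d : measure_display)
    (T : measurableType d) (Pr : probability T R) (I : finType) (Y : T -> I)
    (A : set T) :
  measurable A -> (forall i, measurable (Y @^-1` [set i])) ->
  Pr A = (\sum_i Pr (A `&` Y @^-1` [set i]))%E.
Proof.
move=> mA mY; rewrite fsbig_seq ?index_enum_uniq //.
rewrite -measure_fin_bigcup.
- congr (Pr _); apply/seteqP; split=> [w Aw|w [i _ []]//].
  by exists (Y w) => //=; rewrite mem_index_enum.
- exact: finite_seq.
- apply/trivIsetP => i j _ _ ij; apply/seteqP; split=> // w /= [[_ wi] [_ wj]].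
  by move: ij; rewrite -wi -wj eqxx.
- by move=> i _; apply: measurableI.
Qed.

Section MarkovChain.
Variables (R : realType) (k : nat) (d : measure_display).
Variables (Omega : measurableType d) (Pr : probability Omega R).
Variables (P : 'M[R]_k.+1) (X : nat -> Omega -> 'I_k.+1).
Hypothesis hX : markov_chain_from0 Pr P X.

Let history (n : nat) (x : nat -> 'I_k.+1) : set Omega :=
  [set w | forall m, (m <= n)%N -> X m w = x m].

Lemma measurable_history n x : measurable (history n x).
Proof.
have -> : history n x = \bigcap_(m in `I_n.+1) (X m @^-1` [set x m]).
  by apply/seteqP; split=> w H m /= mn; apply: H.
by apply: fin_bigcap_measurable => // m _; apply: (mc_measurable hX).
Qed.

(** Product form of the transition rule, which covers null histories too: both sides then vanish. *)
Lemma history_step n x j :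
  (Pr (history n x `&` X n.+1 @^-1` [set j]) =
   Pr (history n x) * (P (x n) j)%:E)%E.
Proof.
have mE := measurable_history n x.
have mXj : measurable (X n.+1 @^-1` [set j]) by apply: (mc_measurable hX).
have [E0|E0] := eqVneq (Pr (history n x)) 0%E.
  rewrite E0 mul0e; apply: (subset_measure0 _ mE) => //.
  exact: measurableI.
have E_gt0 : (0 < Pr (history n x))%E by rewrite lt0e E0 /=.
have finE := fin_num_measure Pr _ mE.
have := mc_transition hX j E_gt0.
rewrite /cond_prob -/(history n x) setIC => <-.
have finEX := fin_num_measure Pr _ (measurableI _ _ mE mXj).
rewrite -{1}(fineK finE) -EFinM mulrCA divff ?mulr1 ?fineK //.
by rewrite fine_eq0.
Qed.

(** Markov property for an event [E] determined by the path up to time [n]: such an event is a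
    finite disjoint union of histories, all ending at [i]. *)
Lemma event_step n (E : set Omega) i j :
  (forall w w', (forall m, (m <= n)%N -> X m w = X m w') -> E w -> E w') ->
  measurable E -> E `<=` X n @^-1` [set i] ->
  (Pr (E `&` X n.+1 @^-1` [set j]) = Pr E * (P i j)%:E)%E.
Proof.
move=> Ehist mE Ei.
pose Y w := [ffun m : 'I_n.+1 => X m w].
(* The values that [inord] gives past [n] are arbitrary; [history n] ignores them. *)
pose path (f : {ffun 'I_n.+1 -> 'I_k.+1}) (m : nat) := f (inord m).
have YE f : Y @^-1` [set f] = history n (path f).
  apply/seteqP; split=> [w /= <- m mn|w H /=].
    by rewrite /path ffunE inordK.
  apply/ffunP => m; rewrite ffunE H /path ?inord_val //.
  by rewrite -ltnS ltn_ord.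
have mY f : measurable (Y @^-1` [set f]).
  by rewrite YE; apply: measurable_history.
have mXj : measurable (X n.+1 @^-1` [set j]) by apply: (mc_measurable hX).
rewrite (prob_partition Pr (measurableI _ _ mE mXj) mY).
rewrite (prob_partition Pr mE mY) ge0_sume_distrl; last by [].
apply: eq_bigr => f _; rewrite setIAC YE.
(* A history is either disjoint from [E] or contained in it. *)
have [->|/set0P[w [Ew Hw]]] := eqVneq (E `&` history n (path f)) set0.
  by rewrite set0I measure0 mul0e.
have -> : E `&` history n (path f) = history n (path f).
  apply: setIidr => w' Hw'; apply: Ehist Ew => m mn.
  by rewrite Hw // Hw'.
have <- : path f n = i by rewrite -(Hw n (leqnn n)); apply: Ei.
exact: history_step.
Qed.

Lemma mc_law n j : Pr (X n @^-1` [set j]) = ((P ^+ n) ord0 j)%:E.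
Proof.
have mX m i : measurable (X m @^-1` [set i]) by apply: (mc_measurable hX).
elim: n j => [|n IHn] j.
  rewrite expr0 mxE; case: eqP => [<-|j0]; first exact: (mc_init hX).
  have null0 : Pr (~` (X 0%N @^-1` [set ord0])) = 0%E.
    by rewrite probability_setC // (mc_init hX) subee.
  apply: subset_measure0 null0 => //; first exact: measurableC.
  by move=> w /= -> /esym.
rewrite (prob_partition Pr (mX n.+1 j) (mX n)) exprSr mxE -sumEFin.
apply: eq_bigr => i _; rewrite setIC (event_step _ (i := i)) ?IHn ?EFinM //.
by move=> w w' H /= <-; rewrite H.
Qed.

Hypothesis hP : absorbing P ord_max.

Let hit n : set Omega := [set w | exists2 m, (m <= n)%N & X m w = ord_max].

Lemma measurable_hit n : measurable (hit n).
Proof.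
have -> : hit n = \bigcup_(m in `I_n.+1) (X m @^-1` [set ord_max]).
  by apply/seteqP; split=> w [m mn Xm]; exists m.
by apply: fin_bigcup_measurable => // m _; apply: (mc_measurable hX).
Qed.

(** Leaving the absorbing state is a null event at each step, so [hit n] and [X n = ord_max] differ
    by a null set. *)
Lemma prob_hit n : Pr (hit n) = ((P ^+ n) ord0 ord_max)%:E.
Proof.
have mX m B : measurable (X m @^-1` B) by apply: (mc_measurable hX).
have mD m : measurable (hit m `\` X m @^-1` [set ord_max]).
  by apply: measurableD => //; apply: measurable_hit.
have left0 m : Pr (X m @^-1` [set ord_max] `\` X m.+1 @^-1` [set ord_max]) = 0%E.
  have stay : Pr (X m @^-1` [set ord_max] `&` X m.+1 @^-1` [set ord_max]) =
              Pr (X m @^-1` [set ord_max]).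
    rewrite (event_step (n := m) (i := ord_max)) //.
      by rewrite (hP : P _ _ = 1) mule1.
    by move=> w w' H /= <-; rewrite H.
  transitivity (Pr (X m @^-1` [set ord_max]) -
      Pr (X m @^-1` [set ord_max] `&` X m.+1 @^-1` [set ord_max]))%E.
    by apply: measureD => //; rewrite ltey_eq fin_num_measure.
  by rewrite stay subee // fin_num_measure.
have hit0 : Pr (hit n `\` X n @^-1` [set ord_max]) = 0%E.
  elim: n => [|n IHn].
    have -> : hit 0%N `\` X 0%N @^-1` [set ord_max] = set0.
      apply/seteqP; split=> // w [[m m0 Xm] []] /=.
      by move: m0 Xm; rewrite leqn0 => /eqP->.
    exact: measure0.
  (* A path that has hit [ord_max] but is elsewhere at time [n.+1] was already elsewhere at time
     [n], or left in the last step. *)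
  have null0 : Pr ((hit n `\` X n @^-1` [set ord_max]) `|`
      (X n @^-1` [set ord_max] `\` X n.+1 @^-1` [set ord_max])) = 0%E.
    rewrite measureU0 //; first exact: measurableD.
    exact: left0.
  apply: subset_measure0 null0 => //.
    by apply: measurableU => //; apply: measurableD.
  move=> w [[m mn Xm] XnS].
  have mn' : (m <= n)%N.
    move: mn; rewrite leq_eqVlt => /predU1P[mE|//].
    by case: XnS; rewrite -mE.
  have [Xn|Xn] := pselect (X n w = ord_max); first by right.
  by left; split=> //; exists m.
transitivity (Pr (hit n `\` X n @^-1` [set ord_max]) +
              Pr (hit n `&` X n @^-1` [set ord_max]))%E.
  by apply: measureDI => //; apply: measurable_hit.
rewrite -mc_law hit0 add0e.
by congr (Pr _); apply: setIidr => w Xn; exists n.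
Qed.

(** * Tails of the hitting time and their comparison *)

(** The hitting time is a natural number or [+oo], so it exceeds [t] exactly off
    [hit (truncn t)]. *)
Lemma prob_hitting_time_gt (t : R) : 0 <= t ->
  (Pr [set w | (t%:E < hitting_time R X w)%E] =
   1 - ((P ^+ Num.truncn t) ord0 ord_max)%:E)%E.
Proof.
move=> t0; rewrite -prob_hit -probability_setC; last exact: measurable_hit.
congr (Pr _); apply/seteqP; split=> w /=; rewrite /hitting_time.
  move=> /lt_nat_einf tX [m]; rewrite truncn_ge_nat // => mt Xm.
  by have := tX m; rewrite /= Xm leqnn ltNge mt => /(_ isT).
move=> nhit; apply/lt_nat_einf => n /= kX.
rewrite ltNge; apply/negP => nt; apply: nhit; exists n.
  by rewrite truncn_ge_nat.
by apply/val_inj/eqP; rewrite eqn_leq kX leq_ord.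
Qed.

Lemma prob_hitting_time_gt_neg (t : R) : t < 0 ->
  Pr [set w | (t%:E < hitting_time R X w)%E] = 1%E.
Proof.
move=> t0; rewrite -[RHS](@probability_setT _ _ _ Pr); congr (Pr _).
apply/seteqP; split=> // w _; apply/lt_nat_einf => n _.
exact: lt_le_trans t0 (ler0n _ _).
Qed.

End MarkovChain.

Theorem proposition1 (R : realType) (k : nat) (hk : (1 <= k)%N)
    (d d' : measure_display)
    (Omega : measurableType d) (Omega' : measurableType d')
    (Pr : probability Omega R) (Pr' : probability Omega' R)
    (P P' : 'M[R]_k.+1)
    (X : nat -> Omega -> 'I_k.+1) (X' : nat -> Omega' -> 'I_k.+1)
    (hX : markov_chain_from0 Pr P X) (hX' : markov_chain_from0 Pr' P' X')
    (hP : absorbing P ord_max) (hP' : absorbing P' ord_max)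
    (n1 n2 : nat) (hn1 : (0 < n1)%N) (hn2 : (0 < n2)%N)
    (hcop : coprime n1 n2)
    (hdom1 : mx_dominated (P' ^+ n1) (P ^+ n1))
    (hdom2 : mx_dominated (P' ^+ n2) (P ^+ n2)) :
  ast_le Pr Pr' (hitting_time R X) (hitting_time R X') /\
  ((forall n : nat, (1 <= n)%N -> (n%:R%:E <= hat_n R n1 n2 - 1)%E ->
      (P' ^+ n) ord0 ord_max <= (P ^+ n) ord0 ord_max) ->
   st_le Pr Pr' (hitting_time R X) (hitting_time R X')).
Proof.
have P_st n : stochastic_mx (P ^+ n) := stochastic_mxX n (mc_stochastic hX).
have P'_st n : stochastic_mx (P' ^+ n) := stochastic_mxX n (mc_stochastic hX').
have dom a b : (P' ^+ (a * n1 + b * n2)) ord0 ord_max <=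
               (P ^+ (a * n1 + b * n2)) ord0 ord_max.
  (* Each power splits as an [a]-th power of the [n1]-step matrix times a [b]-th power of the
     [n2]-step one. *)
  apply: mx_dominated_ord0_max; rewrite !exprD !(mulnC _ n1, mulnC _ n2) !exprM.
  by apply: mx_dominatedM; try exact: stochastic_mxX; exact: mx_dominatedX.
have tailP t : 0 <= t ->
    (P' ^+ Num.truncn t) ord0 ord_max <= (P ^+ Num.truncn t) ord0 ord_max ->
    (Pr [set w | (t%:E < hitting_time R X w)%E] <=
     Pr' [set w | (t%:E < hitting_time R X' w)%E])%E.
  move=> t0 le_t.
  rewrite (prob_hitting_time_gt hX hP t0) (prob_hitting_time_gt hX' hP' t0).
  by rewrite -!EFinB lee_fin lerB.
split.
  (* From [n1 * n2] on, every integer part [truncn t] is representable. *)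
  exists (n1 * n2)%:R => t n12t.
  have t0 : 0 <= t := le_trans (ler0n _ _) n12t.
  apply: tailP => //.
  have [|a [b ->]] := coprime_representable hn1 hn2 hcop (r := Num.truncn t).
    by rewrite truncn_ge_nat.
  exact: dom.
move=> dom_small t; have [t0|t0] := leP 0 t; last first.
  by rewrite (prob_hitting_time_gt_neg Pr X t0)
             (prob_hitting_time_gt_neg Pr' X' t0).
apply: tailP => //; set n := Num.truncn t.
pose S := [set r | forall r', (r <= r')%N ->
                     exists a b : nat, r' = (a * n1 + b * n2)%N].
(* [S] contains [n1 * n2], so [hat_n] is its least element [r]. *)
have [|r Sr rmin] := @nat_set_min S.
  by exists (n1 * n2)%N => r'; apply: coprime_representable.
have [rn|nr] := leqP r n.
  by have [a [b ->]] := Sr n rn; apply: dom.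
(* Below [r] the extra hypothesis applies, except at time 0, where both powers are the identity. *)
case: n nr => [_|n nr]; first by rewrite !expr0.
apply: dom_small => //.
rewrite /hat_n -/S (nat_einf_min R Sr rmin) -EFinB lee_fin lerBrDr.
by rewrite natr1 ler_nat.
Qed.
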